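(* Let $f(y),k(y)$ be smooth nonvanishing functions on a real interval and let $K$ be a real constant. If the coefficients of the reduced Riccati equation $$\frac{dv}{dy}=f(y)+k(y)v^2$$ satisfy the condition $$\frac{d}{dy}\left[\sqrt{\frac{f(y)}{k(y)}}\right]=Kf(y),$$ then the Riccati equation is exactly integrable, and its solution is given by $$v(y)=\sqrt{\frac{f(y)}{k(y)}}\left\{\sqrt{1-\frac{K^2}{4}}\,\tan\left\{\sqrt{1-\frac{K^2}{4}}\left[\int\sqrt{f(y)k(y)}\,dy+C\right]\right\}+\frac{K}{2}\right\},\qquad K\neq\pm2,$$ $$v(y)=\sqrt{\frac{f(y)}{k(y)}}\left[-\frac{1}{\int\sqrt{f(y)k(y)}\,dy+C}\mp1\right],\qquad K=\mp2,$$ where $C$ is an arbitrary integration constant.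
   Context: A differential equation is called (exactly) integrable if it can be solved by quadratures, i.e. by definite or indefinite integrals. The branches of the square roots are chosen so that $\sqrt{f/k}\,\sqrt{fk}=f$ (for $f,k>0$ these are the usual positive roots). When $|K|>2$, $\sqrt{1-K^2/4}$ is imaginary and $\tan$ is understood as the complex tangent (either choice of the root gives the same formula). The formulas hold on domains where they are defined. $\int(\cdot)\,dy$ denotes an antiderivative. In the second formula the upper signs go together and the lower signs go together.
   Formalization: The formulas give every solution except those with v divided by sqrt(f/k) constant, namely K/2 ± i·sqrt(1−K²/4) (K/2 when K = ±2), which correspond to C = ∞ and are listed as exceptions; C ranges over the complex numbers. *)

(* Defs.v *)
From Stdlib Require Import Reals List.
From Coquelicot Require Import Coquelicot.
Import ListNotations.

Open Scope R_scope.

(* Intervals may be open, closed or half-open, bounded or not; only the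
   degenerate ones (empty or a single point) are excluded. *)
Definition interval (I : R -> Prop) : Prop :=
  (exists a b, a < b /\ I a /\ I b) /\
  (forall a b x, I a -> I b -> a <= x <= b -> I x).

(* This is [is_derive] with [locally y] replaced by [within D (locally y)]: it is
   the ordinary derivative at interior points of [D] and the one-sided one at
   an endpoint of an interval. *)
Definition is_derive_on {V : NormedModule R_AbsRing}
    (D : R -> Prop) (h : R -> V) (y : R) (l : V) : Prop :=
  filterdiff h (within D (locally y)) (fun t : R => scal t l).

Definition smooth_on (I : R -> Prop) (h : R -> R) : Prop :=
  exists d : nat -> R -> R,
    (forall y, I y -> d O y = h y) /\
    (forall n y, I y -> is_derive_on I (d n) y (d (S n) y)).

Definition antiderivative_on (D : R -> Prop) (u U : R -> C) : Prop :=
  forall y, D y -> is_derive_on D U y (u y).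

Definition Cexp (z : C) : C :=
  (exp (fst z) * cos (snd z), exp (fst z) * sin (snd z)).

Definition Ccos (z : C) : C := ((Cexp (Ci * z) + Cexp (- (Ci * z))) / 2)%C.

Definition Csin (z : C) : C := ((Cexp (Ci * z) - Cexp (- (Ci * z))) / (2 * Ci))%C.

(* Meaningful only where [Ccos z <> 0]. *)
Definition Ctan (z : C) : C := (Csin z / Ccos z)%C.

(* [s] and [g] are branches of sqrt(f/k) and sqrt(f k) with s g = f.  They are
   complex valued because f/k may be negative; when f, k < 0 the relation
   s g = f forces opposite signs on the two real roots. *)
Definition root_branches (I : R -> Prop) (f k : R -> R) (s g : R -> C) : Prop :=
  forall y, I y ->
    (s y * s y)%C = RtoC (f y / k y) /\
    (g y * g y)%C = RtoC (f y * k y) /\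
    (s y * g y)%C = RtoC (f y) /\
    (0 < f y -> 0 < k y ->
       s y = RtoC (sqrt (f y / k y)) /\ g y = RtoC (sqrt (f y * k y))).

(* Solutions may be complex valued, since the constant of integration and the
   root of 1 - K^2/4 may be non-real; real solutions are those of the form
   [fun y => RtoC (w y)]. *)
Definition riccati_solution (D : R -> Prop) (f k : R -> R) (v : R -> C) : Prop :=
  forall y, D y -> is_derive_on D v y (f y + k y * (v y * v y))%C.

(* Functions on [D] obtained from the coefficients and constants by finitely many
   rational operations, square roots, exponentials and indefinite integrals. *)
Inductive by_quadratures (D : R -> Prop) (f k : R -> R) : (R -> C) -> Prop :=
| bq_f : by_quadratures D f k (fun y => RtoC (f y))
| bq_k : by_quadratures D f k (fun y => RtoC (k y))
| bq_const (c : C) : by_quadratures D f k (fun _ => c)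
| bq_plus u w : by_quadratures D f k u -> by_quadratures D f k w ->
    by_quadratures D f k (fun y => (u y + w y)%C)
| bq_mult u w : by_quadratures D f k u -> by_quadratures D f k w ->
    by_quadratures D f k (fun y => (u y * w y)%C)
| bq_inv u : by_quadratures D f k u -> (forall y, D y -> u y <> RtoC 0) ->
    by_quadratures D f k (fun y => (/ u y)%C)
| bq_sqrt u w : by_quadratures D f k u -> (forall y, D y -> u y <> RtoC 0) ->
    continuous_on D w -> (forall y, D y -> (w y * w y)%C = u y) ->
    by_quadratures D f k w
| bq_exp u : by_quadratures D f k u -> by_quadratures D f k (fun y => Cexp (u y))
| bq_int u U : by_quadratures D f k u -> antiderivative_on D u U ->
    by_quadratures D f k U
| bq_ext u w : by_quadratures D f k u -> (forall y, D y -> w y = u y) ->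
    by_quadratures D f k w.

Definition exactly_integrable (I : R -> Prop) (f k : R -> R) : Prop :=
  forall (J : R -> Prop) (v : R -> C),
    interval J -> (forall y, J y -> I y) ->
    riccati_solution J f k v -> by_quadratures J f k v.

(* The family [F c], defined at the points satisfying [def c], solves the equation
   for every value of the constant [c], and every solution on a subinterval is a
   member of the family, apart from the listed ones, meant to be the limits of
   [F c] as [c] goes to infinity in suitable complex directions; without them the
   completeness clause would be false. *)
Definition general_solution (I : R -> Prop) (f k : R -> R)
    (def : C -> R -> Prop) (F : C -> R -> C) (limits : list (R -> C)) : Prop :=
  (forall c : C, riccati_solution (fun y => I y /\ def c y) f k (F c)) /\
  (forall (J : R -> Prop) (v : R -> C),
     interval J -> (forall y, J y -> I y) -> riccati_solution J f k v ->
     (exists c : C, forall y, J y -> def c y /\ v y = F c y) \/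
     (exists u : R -> C, In u limits /\ forall y, J y -> v y = u y)).

(* Main.v *)
(* Write v = s w.  Since f = s g, k = g / s and s' = K s g, the Riccati equation
   becomes w' = g (1 - K w + w^2), with constant coefficients up to the factor g.

   If K = 2 e with e = 1 or -1, then p = w - e satisfies p' = g p^2.  Otherwise
   i r + K / 2 is a root of 1 - K w + w^2, so a = w - (i r + K / 2) satisfies
   a' = g (a^2 + 2 i r a), and p = a exp (- 2 i r G) satisfies p' = m p^2 with
   m = g exp (2 i r G), whose antiderivative is M = exp (2 i r G) / (2 i r).
   By uniqueness for the linear equation p' = (m p) p, either p vanishes
   identically or it never vanishes; in the latter case 1 / p + M is a constant c.
   Solving for w gives the stated families, c = 0 yielding the second exceptional
   solution when K is neither 2 nor -2. *)

Require Import Defs.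
From Stdlib Require Import Reals List Lra Classical.
From Coquelicot Require Import Coquelicot.
Import ListNotations.
Open Scope R_scope.

(** * Calculus of derivatives relative to a set, real and complex *)

Section OneSidedDerivatives.

Context {D : R -> Prop} {y : R} (Dy : D y).

(** The centre [y] belongs to every set of the filter, because it belongs to [D]. *)
Lemma within_proper : ProperFilter (within D (locally y)).
Proof.
split; [| apply within_filter, locally_filter].
intros P [e HP]. exists y. apply HP; [apply ball_center | exact Dy].
Qed.

Lemma is_filter_lim_within : is_filter_lim (within D (locally y)) y.
Proof. intros P HP. apply filter_le_within; exact HP. Qed.

(** [filterdiff] imposes its little-o condition at every limit of the filter; uniqueness of limits
    reduces this to the point [y]. *)
Lemma is_filter_lim_within_eq (x : R) :
  is_filter_lim (within D (locally y)) x -> x = y.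
Proof.
intros Hx.
pose proof within_proper as P.
apply (is_filter_lim_unique (K := R_AbsRing) (V := R_NormedModule)
         (F := within D (locally y))).
- exact Hx.
- exact is_filter_lim_within.
Qed.

Lemma is_derive_on_ext {V : NormedModule R_AbsRing} (h1 h2 : R -> V) (l1 l2 : V) :
  (forall t, D t -> h1 t = h2 t) -> l1 = l2 ->
  is_derive_on D h1 y l1 -> is_derive_on D h2 y l2.
Proof.
intros E <- H. unfold is_derive_on.
apply (filterdiff_ext_loc (F := within D (locally y)) h1); auto.
- exists (mkposreal 1 Rlt_0_1). intros t _. apply E.
- intros x Hx. rewrite (is_filter_lim_within_eq x Hx). auto.
Qed.

(** The filter within the smaller set is finer. This carries derivatives from [I] to subintervals
    and to the domains of the formulas. *)
Lemma is_derive_on_sub {V : NormedModule R_AbsRing} (D' : R -> Prop)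
    (h : R -> V) (l : V) :
  (forall t, D t -> D' t) -> is_derive_on D' h y l -> is_derive_on D h y l.
Proof.
intros S [L H]. split; [exact L |].
intros x Hx eps. rewrite (is_filter_lim_within_eq x Hx).
assert (Hy : is_filter_lim (within D' (locally y)) y).
{ intros P HP. apply filter_le_within; exact HP. }
destruct (H y Hy eps) as [e He]. exists e. intros t Ht Dt. exact (He t Ht (S t Dt)).
Qed.

Lemma is_derive_on_is_derive {V : NormedModule R_AbsRing} (h : R -> V) (l : V) :
  is_derive h y l -> is_derive_on D h y l.
Proof.
intros H. unfold is_derive_on.
pose proof within_proper as P.
apply (filterdiff_locally (U := R_NormedModule) (F := within D (locally y)) h y).
- exact is_filter_lim_within.
- exact H.
Qed.

Lemma is_derive_on_continuous {V : NormedModule R_AbsRing} (h : R -> V) (l : V) :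
  is_derive_on D h y l -> filterlim h (within D (locally y)) (locally (h y)).
Proof.
intros H. apply (filterdiff_continuous_aux (K := R_AbsRing) (U := R_NormedModule)).
- eexists. exact H.
- exact is_filter_lim_within.
Qed.

Lemma is_derive_on_comp (h phi : R -> R) (l m : R) :
  is_derive_on D h y l -> is_derive phi (h y) m ->
  is_derive_on D (fun t => phi (h t)) y (l * m).
Proof.
intros Hh Hphi. unfold is_derive_on.
eapply filterdiff_ext_lin.
- apply (filterdiff_comp (U := R_NormedModule) (V := R_NormedModule)
           (W := R_NormedModule) h phi) with (1 := Hh).
  (* By continuity of [h] the image filter is finer than the neighbourhoods of [h y], so the full
     derivative of [phi] applies along it. *)
  pose proof (filtermap_proper_filter _ _ h _ within_proper) as FP.
  apply (filterdiff_locally (U := R_NormedModule)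
           (F := filtermap h (within D (locally y))) phi (h y)).
  + intros P HP. exact (is_derive_on_continuous h l Hh P HP).
  + exact Hphi.
- intros t. unfold scal; simpl; unfold mult; simpl. ring.
Qed.

Lemma is_derive_on_Rmult (h1 h2 : R -> R) (l1 l2 : R) :
  is_derive_on D h1 y l1 -> is_derive_on D h2 y l2 ->
  is_derive_on D (fun t => h1 t * h2 t) y (l1 * h2 y + h1 y * l2).
Proof.
intros H1 H2. unfold is_derive_on.
eapply filterdiff_ext_lin.
(* The product rule is the chain rule for the differential of multiplication at [(h1 y, h2 y)]. *)
- apply (filterdiff_comp_2 (T := R_NormedModule) (U := R_NormedModule)
    (V := R_NormedModule) (W := R_NormedModule) h1 h2 Rmult _ _
    (fun a b => a * h2 y + h1 y * b) H1 H2).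
  pose proof (filtermap_proper_filter _ _ (fun t => (h1 t, h2 t)) _ within_proper) as FP.
  apply (filterdiff_mult (K := R_AbsRing)
    (F := filtermap (fun t => (h1 t, h2 t)) (within D (locally y))) (h1 y, h2 y)).
  + intros P [e HP].
    generalize (filterlim_pair _ _ (is_derive_on_continuous h1 l1 H1)
                  (is_derive_on_continuous h2 l2 H2)).
    intros Hl. apply Hl.
    exists (ball (h1 y) e) (ball (h2 y) e); try apply locally_ball.
    intros a b Ha Hb. apply HP. split; assumption.
  + exact Rmult_comm.
- intros t. unfold scal; simpl; unfold mult; simpl. ring.
Qed.

Lemma is_derive_on_plus {V : NormedModule R_AbsRing} (h1 h2 : R -> V) (l1 l2 : V) :
  is_derive_on D h1 y l1 -> is_derive_on D h2 y l2 ->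
  is_derive_on D (fun t => plus (h1 t) (h2 t)) y (plus l1 l2).
Proof.
intros H1 H2. unfold is_derive_on.
eapply filterdiff_ext_lin.
- apply (filterdiff_plus_fct _ _ _ _ H1 H2).
- intros t. symmetry. apply (scal_distr_l (K := R_AbsRing) (V := V)).
Qed.

Lemma is_derive_on_Rplus (h1 h2 : R -> R) (l1 l2 : R) :
  is_derive_on D h1 y l1 -> is_derive_on D h2 y l2 ->
  is_derive_on D (fun t => h1 t + h2 t) y (l1 + l2).
Proof. exact (is_derive_on_plus (V := R_NormedModule) h1 h2 l1 l2). Qed.

Lemma is_derive_on_const {V : NormedModule R_AbsRing} (a : V) :
  is_derive_on D (fun _ => a) y zero.
Proof.
unfold is_derive_on. eapply filterdiff_ext_lin.
- apply filterdiff_const.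
- intros t. symmetry. apply (scal_zero_r (K := R_AbsRing) (V := V)).
Qed.

Lemma is_derive_on_fst (h : R -> C) (l : C) :
  is_derive_on D h y l -> is_derive_on D (fun t => fst (h t)) y (fst l).
Proof.
intros H. unfold is_derive_on.
apply (filterdiff_comp (U := R_NormedModule)
    (V := prod_NormedModule R_AbsRing R_NormedModule R_NormedModule)
    (W := R_NormedModule) h fst _ fst H).
apply filterdiff_linear, is_linear_fst.
Qed.

Lemma is_derive_on_snd (h : R -> C) (l : C) :
  is_derive_on D h y l -> is_derive_on D (fun t => snd (h t)) y (snd l).
Proof.
intros H. unfold is_derive_on.
apply (filterdiff_comp (U := R_NormedModule)
    (V := prod_NormedModule R_AbsRing R_NormedModule R_NormedModule)
    (W := R_NormedModule) h snd _ snd H).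
apply filterdiff_linear, is_linear_snd.
Qed.

Lemma is_derive_on_pair (h : R -> C) (l : C) :
  is_derive_on D (fun t => fst (h t)) y (fst l) ->
  is_derive_on D (fun t => snd (h t)) y (snd l) ->
  is_derive_on D h y l.
Proof.
intros H1 H2.
apply (is_derive_on_ext (fun t => (fst (h t), snd (h t)) : C) h l l);
  [intros t _; symmetry; apply surjective_pairing | reflexivity |].
unfold is_derive_on.
apply (filterdiff_comp_2 (T := R_NormedModule) (U := R_NormedModule)
    (V := R_NormedModule) (W := prod_NormedModule R_AbsRing R_NormedModule R_NormedModule)
    _ _ (fun a b => (a, b)) _ _ (fun a b => (a, b)) H1 H2).
apply filterdiff_linear, is_linear_prod; [apply is_linear_fst | apply is_linear_snd].
Qed.

Lemma is_derive_on_RtoC (h : R -> R) (l : R) :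
  is_derive_on D h y l -> is_derive_on D (fun t => RtoC (h t)) y (RtoC l).
Proof.
intros H. apply is_derive_on_pair; [exact H |].
exact (is_derive_on_const (V := R_NormedModule) 0).
Qed.

Lemma is_derive_on_Cconst (a : C) : is_derive_on D (fun _ => a) y (RtoC 0).
Proof.
exact (is_derive_on_const (V := prod_NormedModule R_AbsRing R_NormedModule R_NormedModule) a).
Qed.

(** Values are fixed to lie in [C], so that the goals left by its use are complex equations for
    [ring] and [field]. *)
Lemma is_derive_on_Cext (h1 h2 : R -> C) (l1 l2 : C) :
  (forall t, D t -> h1 t = h2 t) -> l1 = l2 ->
  is_derive_on D h1 y l1 -> is_derive_on D h2 y l2.
Proof. apply is_derive_on_ext. Qed.

Lemma is_derive_on_Cplus (h1 h2 : R -> C) (l1 l2 : C) :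
  is_derive_on D h1 y l1 -> is_derive_on D h2 y l2 ->
  is_derive_on D (fun t => h1 t + h2 t)%C y (l1 + l2)%C.
Proof.
exact (is_derive_on_plus (V := prod_NormedModule R_AbsRing R_NormedModule R_NormedModule) h1 h2 l1 l2).
Qed.

Lemma is_derive_on_Cmult (h1 h2 : R -> C) (l1 l2 : C) :
  is_derive_on D h1 y l1 -> is_derive_on D h2 y l2 ->
  is_derive_on D (fun t => h1 t * h2 t)%C y (l1 * h2 y + h1 y * l2)%C.
Proof.
intros H1 H2.
pose proof (is_derive_on_fst _ _ H1) as a1. pose proof (is_derive_on_snd _ _ H1) as b1.
pose proof (is_derive_on_fst _ _ H2) as a2. pose proof (is_derive_on_snd _ _ H2) as b2.
(* The constant [-1] turns the difference in the real part into a sum of products. *)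
assert (Hm : is_derive_on D (fun _ : R => -1) y 0).
{ exact (is_derive_on_const (V := R_NormedModule) (-1)). }
apply is_derive_on_pair.
- eapply is_derive_on_ext;
    [| | exact (is_derive_on_Rplus _ _ _ _ (is_derive_on_Rmult _ _ _ _ a1 a2)
           (is_derive_on_Rmult _ _ _ _ Hm (is_derive_on_Rmult _ _ _ _ b1 b2)))].
  + intros t _. simpl. ring.
  + simpl. ring.
- eapply is_derive_on_ext;
    [reflexivity | | exact (is_derive_on_Rplus _ _ _ _ (is_derive_on_Rmult _ _ _ _ a1 b2)
           (is_derive_on_Rmult _ _ _ _ b1 a2))].
  simpl. ring.
Qed.

Lemma is_derive_on_Cscal (a : C) (h : R -> C) (l : C) :
  is_derive_on D h y l -> is_derive_on D (fun t => a * h t)%C y (a * l)%C.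
Proof.
intros H. apply (is_derive_on_Cext (fun t => a * h t)%C _ (0 * h y + a * l)%C);
  [reflexivity | ring |].
exact (is_derive_on_Cmult _ _ _ _ (is_derive_on_Cconst a) H).
Qed.

Lemma is_derive_on_Copp (h : R -> C) (l : C) :
  is_derive_on D h y l -> is_derive_on D (fun t => - h t)%C y (- l)%C.
Proof.
intros H. apply (is_derive_on_Cext (fun t => - (1) * h t)%C _ (- (1) * l)%C);
  [intros t _; ring | ring |].
exact (is_derive_on_Cscal _ _ _ H).
Qed.

Lemma is_derive_on_Cminus (h1 h2 : R -> C) (l1 l2 : C) :
  is_derive_on D h1 y l1 -> is_derive_on D h2 y l2 ->
  is_derive_on D (fun t => h1 t - h2 t)%C y (l1 - l2)%C.
Proof.
intros H1 H2. exact (is_derive_on_Cplus _ _ _ _ H1 (is_derive_on_Copp _ _ H2)).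
Qed.

(** The inverse is the conjugate divided by the squared modulus [N], so each component is a product
    of real functions. *)
Lemma is_derive_on_Cinv (h : R -> C) (l : C) :
  h y <> RtoC 0 -> is_derive_on D h y l ->
  is_derive_on D (fun t => / h t)%C y (- (l / (h y * h y)))%C.
Proof.
intros Hy H.
pose proof (is_derive_on_fst _ _ H) as da. pose proof (is_derive_on_snd _ _ H) as db.
set (N := fun t => fst (h t) * fst (h t) + snd (h t) * snd (h t)).
assert (HN : N y <> 0).
{ intros E. apply Hy. unfold N in E.
  apply Rplus_sqr_eq_0 in E. rewrite (surjective_pairing (h y)).
  destruct E as [-> ->]. reflexivity. }
assert (dN := is_derive_on_Rplus _ _ _ _ (is_derive_on_Rmult _ _ _ _ da da)
                (is_derive_on_Rmult _ _ _ _ db db)).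
assert (dI := is_derive_on_comp N Rinv _ _ dN
                (is_derive_inv (fun x => x) (N y) 1 (is_derive_id _) HN)).
assert (dm := is_derive_on_Rmult _ _ _ _ (is_derive_on_const (V := R_NormedModule) (-1)) db).
unfold N in HN.
apply is_derive_on_pair.
- eapply is_derive_on_ext; [| | exact (is_derive_on_Rmult _ _ _ _ da dI)].
  + intros t _. unfold N; simpl. unfold Rdiv. rewrite !Rmult_1_r. reflexivity.
  + unfold N, zero, one; simpl. field. split; [| exact HN].
    intros E. apply HN. nra.
- eapply is_derive_on_ext; [| | exact (is_derive_on_Rmult _ _ _ _ dm dI)].
  + intros t _. unfold N; simpl. unfold Rdiv. rewrite !Rmult_1_r. ring.
  + unfold N, zero, one; simpl. field. split; [| exact HN].
    intros E. apply HN. nra.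
Qed.

Lemma is_derive_on_Cexp (h : R -> C) (l : C) :
  is_derive_on D h y l -> is_derive_on D (fun t => Cexp (h t)) y (l * Cexp (h y))%C.
Proof.
intros H.
pose proof (is_derive_on_fst _ _ H) as da. pose proof (is_derive_on_snd _ _ H) as db.
assert (de := is_derive_on_comp _ _ _ _ da (is_derive_exp _)).
apply is_derive_on_pair.
- assert (dc := is_derive_on_comp _ _ _ _ db (is_derive_cos _)).
  eapply is_derive_on_ext; [| | exact (is_derive_on_Rmult _ _ _ _ de dc)]; [reflexivity |].
  simpl. ring.
- assert (ds := is_derive_on_comp _ _ _ _ db (is_derive_sin _)).
  eapply is_derive_on_ext; [| | exact (is_derive_on_Rmult _ _ _ _ de ds)]; [reflexivity |].
  simpl. ring.
Qed.

End OneSidedDerivatives.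

(** * Constancy and antiderivatives on arbitrary intervals *)

Definition clamp (a b x : R) : R := Rmax a (Rmin b x).

Lemma clamp_in (a b x : R) : a <= b -> a <= clamp a b x <= b.
Proof.
intros ab. unfold clamp, Rmax, Rmin.
destruct (Rle_dec b x); destruct (Rle_dec a _); lra.
Qed.

Lemma clamp_id (a b x : R) : a <= x <= b -> clamp a b x = x.
Proof.
intros Hx. unfold clamp. rewrite Rmin_right by lra. apply Rmax_right. lra.
Qed.

Lemma clamp_dist (a b x y : R) : Rabs (clamp a b y - clamp a b x) <= Rabs (y - x).
Proof.
unfold clamp, Rmax, Rmin.
destruct (Rle_dec b x); destruct (Rle_dec b y);
  repeat destruct (Rle_dec a _); unfold Rabs; repeat destruct (Rcase_abs _); lra.
Qed.

(* Clamping to [a, b] turns one-sided continuity on [J] into continuity on all of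
   R, so that the library's theorems apply at endpoints. *)
Lemma continuous_clamp (J : R -> Prop) (h : R -> R) (a b x : R) :
  interval J -> continuous_on J h -> J a -> J b -> a <= b ->
  continuous (fun t => h (clamp a b t)) x.
Proof.
intros HJ Hh Ja Jb ab.
assert (Jc : forall t, J (clamp a b t)).
{ intros t. apply (proj2 HJ a b); auto. apply clamp_in, ab. }
intros P HP. destruct (Hh _ (Jc x) P HP) as [e He].
exists e. intros t Ht. apply He; [| apply Jc].
eapply Rle_lt_trans; [apply clamp_dist | exact Ht].
Qed.

(** Mean value theorem for the clamped function, which is continuous everywhere and has derivative
    zero strictly between [a] and [b]. *)
Lemma is_derive_on_zero_eq_aux (J : R -> Prop) (h : R -> R) (a b : R) :
  interval J -> (forall y, J y -> is_derive_on J h y 0) -> J a -> J b -> a < b ->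
  h a = h b.
Proof.
intros HJ Hh Ja Jb ab.
set (H := fun t => h (clamp a b t)).
destruct (MVT_gen H a b (fun _ => 0)) as [c [_ E]].
- intros x. rewrite Rmin_left, Rmax_right by lra. intros Hx.
  assert (Jx : J x) by (apply (proj2 HJ a b); auto; lra).
  destruct (Hh x Jx) as [L Hd]. split; [exact L |].
  intros z Hz. rewrite <- (is_filter_lim_locally_unique _ _ Hz).
  intros eps. destruct (Hd x (is_filter_lim_within) eps) as [e He].
  (* Within this radius [t] stays between [a] and [b], where clamping is the identity and points lie
     in [J]; the relative derivative thus becomes two-sided. *)
  assert (He' : 0 < Rmin e (Rmin (x - a) (b - x))).
  { repeat apply Rmin_pos; try lra. apply cond_pos. }
  exists (mkposreal _ He'). intros t Ht.
  change (Rabs (t - x) < Rmin e (Rmin (x - a) (b - x))) in Ht.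
  apply Rmin_Rgt_l in Ht. destruct Ht as [Ht1 Ht2].
  apply Rmin_Rgt_l in Ht2. destruct Ht2 as [Ht2 Ht3].
  apply Rabs_def2 in Ht2. apply Rabs_def2 in Ht3.
  unfold H. rewrite !clamp_id by lra. apply He; [exact Ht1 |].
  apply (proj2 HJ a b); auto; lra.
- intros x _. apply continuity_pt_filterlim.
  apply (continuous_clamp J); auto; try lra.
  intros y Jy. eapply (is_derive_on_continuous (V := R_NormedModule)); auto.
- unfold H in E. rewrite !clamp_id in E by lra. lra.
Qed.

Lemma is_derive_on_zero_eq (J : R -> Prop) (h : R -> R) (a b : R) :
  interval J -> (forall y, J y -> is_derive_on J h y 0) -> J a -> J b -> h a = h b.
Proof.
intros HJ Hh Ja Jb. destruct (Rtotal_order a b) as [L | [-> | L]]; auto.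
- apply (is_derive_on_zero_eq_aux J); auto.
- symmetry. apply (is_derive_on_zero_eq_aux J); auto.
Qed.

Lemma is_derive_on_zero_Ceq (J : R -> Prop) (h : R -> C) (a b : R) :
  interval J -> (forall y, J y -> is_derive_on J h y (RtoC 0)) -> J a -> J b ->
  h a = h b.
Proof.
intros HJ Hh Ja Jb. apply injective_projections.
- apply (is_derive_on_zero_eq J (fun t => fst (h t))); auto.
  intros y Jy. exact (is_derive_on_fst h (RtoC 0) (Hh y Jy)).
- apply (is_derive_on_zero_eq J (fun t => snd (h t))); auto.
  intros y Jy. exact (is_derive_on_snd h (RtoC 0) (Hh y Jy)).
Qed.

(** On a side where [J] has points beyond [x], such a point bounds the subinterval; otherwise [x] is
    an extreme point of [J] and serves as the bound itself. Stretching to [p] and [q] ensures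
    [a < b]. *)
Lemma interval_neighbourhood (J : R -> Prop) (x0 x : R) :
  interval J -> J x0 -> J x ->
  exists a b, J a /\ J b /\ a <= x0 <= b /\ a <= x <= b /\ a < b /\
    within J (locally x) (fun t => a <= t <= b).
Proof.
intros [[p [q [pq [Jp Jq]]]] HJ] J0 Jx.
assert (L : exists a, J a /\ a <= x0 /\ a <= x /\ a <= p /\
              within J (locally x) (fun t => a <= t)).
{ destruct (classic (exists a, J a /\ a < x)) as [[a [Ja ax]] | N].
  - exists (Rmin a (Rmin x0 p)).
    assert (M : Rmin a (Rmin x0 p) <= a) by apply Rmin_l.
    assert (M2 : Rmin a (Rmin x0 p) <= Rmin x0 p) by apply Rmin_r.
    pose proof (Rmin_l x0 p). pose proof (Rmin_r x0 p).
    repeat split; try lra.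
    + repeat apply Rmin_case; auto.
    + assert (P : 0 < x - a) by lra. exists (mkposreal _ P). intros t Ht _.
      change (Rabs (t - x) < x - a) in Ht. apply Rabs_def2 in Ht. lra.
  - assert (M : forall t, J t -> x <= t).
    { intros t Jt. apply Rnot_lt_le. intros tx. apply N. exists t. auto. }
    exists x. repeat split; auto; try lra.
    exists (mkposreal 1 Rlt_0_1). intros t _. apply M. }
assert (U : exists b, J b /\ x0 <= b /\ x <= b /\ q <= b /\
              within J (locally x) (fun t => t <= b)).
{ destruct (classic (exists b, J b /\ x < b)) as [[b [Jb xb]] | N].
  - exists (Rmax b (Rmax x0 q)).
    assert (M : b <= Rmax b (Rmax x0 q)) by apply Rmax_l.
    assert (M2 : Rmax x0 q <= Rmax b (Rmax x0 q)) by apply Rmax_r.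
    pose proof (Rmax_l x0 q). pose proof (Rmax_r x0 q).
    repeat split; try lra.
    + repeat apply Rmax_case; auto.
    + assert (P : 0 < b - x) by lra. exists (mkposreal _ P). intros t Ht _.
      change (Rabs (t - x) < b - x) in Ht. apply Rabs_def2 in Ht. lra.
  - assert (M : forall t, J t -> t <= x).
    { intros t Jt. apply Rnot_lt_le. intros tx. apply N. exists t. auto. }
    exists x. repeat split; auto; try lra.
    exists (mkposreal 1 Rlt_0_1). intros t _. apply M. }
destruct L as [a [Ja [a0 [ax [ap Wa]]]]]. destruct U as [b [Jb [b0 [bx [bq Wb]]]]].
exists a, b. repeat split; auto; try lra.
destruct Wa as [e1 W1]. destruct Wb as [e2 W2].
exists (mkposreal _ (Rmin_pos _ _ (cond_pos e1) (cond_pos e2))).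
intros t Ht Jt. change (Rabs (t - x) < Rmin e1 e2) in Ht.
apply Rmin_Rgt_l in Ht. destruct Ht.
split; [apply W1 | apply W2]; auto.
Qed.

(** The integral from a fixed point of [J]. Around [x] the integrand is clamped to a compact
    subinterval: it becomes continuous on the whole line, and the integral is unchanged near [x] in
    [J]. *)
Lemma ex_antiderivative_R (J : R -> Prop) (h : R -> R) :
  interval J -> continuous_on J h ->
  exists H : R -> R, forall y, J y -> is_derive_on J H y (h y).
Proof.
intros HJ Hh.
destruct (proj1 HJ) as [x0 [_ [_ [J0 _]]]].
exists (fun t => RInt h x0 t). intros x Jx.
destruct (interval_neighbourhood J x0 x HJ J0 Jx)
  as [a [b [Ja [Jb [Hx0 [Hx [ab W]]]]]]].
set (hc := fun t => h (clamp a b t)).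
assert (Hc : forall t, continuous hc t).
{ intros t. apply (continuous_clamp J); auto; lra. }
assert (Eq : forall t, a <= t <= b -> RInt hc x0 t = RInt h x0 t).
{ intros t Ht. apply RInt_ext. intros z Hz. unfold hc. rewrite clamp_id; auto.
  revert Hz. unfold Rmin, Rmax. destruct (Rle_dec x0 t); lra. }
assert (Dc : is_derive (fun t => RInt hc x0 t) x (h x)).
{ replace (h x) with (hc x) by (unfold hc; rewrite clamp_id; auto).
  apply (is_derive_RInt (V := R_NormedModule) hc) with x0; auto.
  exists (mkposreal 1 Rlt_0_1). intros t _.
  apply (RInt_correct (V := R_CompleteNormedModule)).
  apply (ex_RInt_continuous (V := R_CompleteNormedModule)). auto. }
unfold is_derive_on.
apply (filterdiff_ext_loc (U := R_NormedModule) (V := R_NormedModule)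
         (F := within J (locally x)) (fun t => RInt hc x0 t)).
- destruct W as [e He]. exists e. intros t Ht Jt. apply Eq. apply He; auto.
- intros z Hz. rewrite (is_filter_lim_within_eq Jx z Hz). auto.
- apply (is_derive_on_is_derive Jx (V := R_NormedModule)). exact Dc.
Qed.

Lemma ex_antiderivative_on (J : R -> Prop) (h : R -> C) :
  interval J -> continuous_on J h -> exists H, antiderivative_on J h H.
Proof.
intros HJ Hh.
destruct (ex_antiderivative_R J (fun t => fst (h t)) HJ) as [H1 D1].
{ intros y Jy P [e HP]. apply (Hh y Jy (fun z => P (fst z))).
  exists e. intros z [Hz _]. apply HP, Hz. }
destruct (ex_antiderivative_R J (fun t => snd (h t)) HJ) as [H2 D2].
{ intros y Jy P [e HP]. apply (Hh y Jy (fun z => P (snd z))).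
  exists e. intros z [_ Hz]. apply HP, Hz. }
exists (fun t => (H1 t, H2 t)). intros y Jy.
apply (is_derive_on_pair Jy); auto.
Qed.

(** * Complex exponential, cosine and tangent *)

Lemma Cexp_plus (z w : C) : Cexp (z + w)%C = (Cexp z * Cexp w)%C.
Proof.
unfold Cexp; simpl. rewrite exp_plus, cos_plus, sin_plus.
apply injective_projections; simpl; ring.
Qed.

Lemma Cexp_0 : Cexp (RtoC 0) = RtoC 1.
Proof.
unfold Cexp; simpl. rewrite exp_0, cos_0, sin_0.
apply injective_projections; simpl; ring.
Qed.

Lemma Cexp_opp (z : C) : (Cexp z * Cexp (- z))%C = RtoC 1.
Proof. rewrite <- Cexp_plus, Cplus_opp_r. exact Cexp_0. Qed.

Lemma C1_neq0 : RtoC 1 <> RtoC 0.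
Proof. intros E. apply RtoC_inj in E. lra. Qed.

Lemma C2_neq0 : RtoC 2 <> RtoC 0.
Proof. intros E. apply RtoC_inj in E. lra. Qed.

Lemma Ci_neq0 : Ci <> RtoC 0.
Proof. intros E. injection E. lra. Qed.

Lemma Ci_mult : (Ci * Ci)%C = (- RtoC 1)%C.
Proof. apply injective_projections; simpl; ring. Qed.

Lemma Cexp_neq0 (z : C) : Cexp z <> RtoC 0.
Proof.
intros E. pose proof (Cexp_opp z) as H. rewrite E, Cmult_0_l in H.
symmetry in H. exact (C1_neq0 H).
Qed.

(** Polar form: the real part of [z] is the logarithm of the modulus, the imaginary part an argument
    of [w]. *)
Lemma Cexp_surj (w : C) : w <> RtoC 0 -> exists z, Cexp z = w.
Proof.
intros Hw. destruct w as [x y].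
set (q := Cmod (x, y)).
assert (Hq : 0 < q) by (apply Cmod_gt_0; exact Hw).
assert (Hq2 : q * q = x * x + y * y).
{ unfold q, Cmod; simpl. rewrite sqrt_sqrt; nra. }
set (u := x / q).
assert (Hu : u * u + (y / q) * (y / q) = 1).
{ unfold u. field_simplify; [| lra]. replace (q ^ 2) with (x ^ 2 + y ^ 2) by lra.
  field. nra. }
assert (Hu1 : -1 <= u <= 1) by (pose proof (Rle_0_sqr (y / q)); unfold Rsqr in *; nra).
assert (Hs : sin (acos u) = Rabs (y / q)).
{ rewrite sin_acos by exact Hu1. rewrite <- sqrt_Rsqr_abs. f_equal. unfold Rsqr. lra. }
(* The sine of [acos u] is nonnegative, so the sign of [y / q] decides between [acos u] and its
   opposite. *)
assert (Ht : exists t, cos t = u /\ sin t = y / q).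
{ destruct (Rle_dec 0 (y / q)).
  - exists (acos u). rewrite cos_acos, Hs, Rabs_right by lra. auto.
  - exists (- acos u). rewrite cos_neg, sin_neg, cos_acos, Hs, Rabs_left by lra.
    split; ring. }
destruct Ht as [t [Hc Hsn]].
exists (ln q, t). unfold Cexp; simpl. rewrite Hc, Hsn, exp_ln by exact Hq.
apply injective_projections; simpl; unfold u; field; lra.
Qed.

Lemma Csqrt_R (x : R) : exists r : C, (r * r)%C = RtoC x.
Proof.
destruct (Rle_dec 0 x).
- exists (RtoC (sqrt x)). rewrite <- RtoC_mult, sqrt_sqrt; auto.
- exists (0, sqrt (- x)). assert (E := sqrt_sqrt (- x)).
  apply injective_projections; simpl; [rewrite Rmult_0_l, E; lra | ring].
Qed.

(** With [e = exp (i z)] one has [e^2 + 1 = 2 e cos z], and [2 e] never vanishes. *)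
Lemma Ccos_neq0 (z : C) :
  Ccos z <> RtoC 0 <-> (Cexp (Ci * z) * Cexp (Ci * z) + 1)%C <> RtoC 0.
Proof.
pose proof (Cexp_opp (Ci * z)) as H. pose proof (Cexp_neq0 (Ci * z)) as N.
pose proof C2_neq0 as N2.
assert (E : (Cexp (Ci * z) * Cexp (Ci * z) + 1 = 2 * Cexp (Ci * z) * Ccos z)%C).
{ unfold Ccos. rewrite <- H. field. }
rewrite E. split.
- intros Hc. apply Cmult_neq_0; [apply Cmult_neq_0 |]; assumption.
- intros Hc E0. apply Hc. rewrite E0. ring.
Qed.

(** Multiplying numerator and denominator by [exp (i z)] makes the tangent a Moebius function of
    [exp (2 i z)], the form in which solutions are matched with the family. *)
Lemma Ctan_Cexp (z : C) : Ccos z <> RtoC 0 ->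
  let X := (Cexp (Ci * z) * Cexp (Ci * z))%C in
  Ctan z = (- Ci * (X - 1) / (X + 1))%C.
Proof.
intros Hc X. pose proof (proj1 (Ccos_neq0 z) Hc) as HX. fold X in HX.
pose proof (Cexp_opp (Ci * z)) as H. pose proof (Cexp_neq0 (Ci * z)) as N.
pose proof C2_neq0 as N2. pose proof Ci_neq0 as Ni.
assert (Em : Cexp (- (Ci * z)) = (/ Cexp (Ci * z))%C).
{ rewrite <- (Cmult_1_r (/ _)), <- H. field; auto. }
unfold Ctan, Csin, Ccos. rewrite Em. unfold X in *.
(* With [/ Ci] in place of [- Ci] the identity is rational in [Ci] and does not involve the value of
   its square. *)
replace (- Ci)%C with (/ Ci)%C.
- field; auto.
- apply injective_projections; simpl; field.
Qed.

Lemma is_derive_on_Ctan {D : R -> Prop} {y : R} (Dy : D y) (h : R -> C) (l : C) :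
  Ccos (h y) <> RtoC 0 -> is_derive_on D h y l ->
  is_derive_on D (fun t => Ctan (h t)) y (l * (1 + Ctan (h y) * Ctan (h y)))%C.
Proof.
intros Hc Hh. pose proof C2_neq0 as N2. pose proof Ci_neq0 as Ni.
assert (Hz := is_derive_on_Cscal Dy Ci h l Hh).
assert (Hn := is_derive_on_Copp Dy _ _ Hz).
apply (is_derive_on_Cexp Dy) in Hz. apply (is_derive_on_Cexp Dy) in Hn.
assert (Hcos : is_derive_on D (fun t => Ccos (h t)) y (- (l * Csin (h y)))%C).
{ eapply (is_derive_on_Cext Dy);
    [| | exact (is_derive_on_Cscal Dy (/ 2)%C _ _ (is_derive_on_Cplus _ _ _ _ Hz Hn))].
  - intros t _. unfold Ccos, Cdiv. ring.
  (* The sign is exposed as a factor [- (1)], which becomes [Ci * Ci]; what remains is a rational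
     identity in [Ci]. *)
  - unfold Csin. replace (- (l * ((Cexp (Ci * h y) - Cexp (- (Ci * h y))) / (2 * Ci))))%C
      with ((- (1)) * (l * ((Cexp (Ci * h y) - Cexp (- (Ci * h y))) / (2 * Ci))))%C by ring.
    rewrite <- Ci_mult. field; auto. }
assert (Hsin : is_derive_on D (fun t => Csin (h t)) y (l * Ccos (h y))%C).
{ eapply (is_derive_on_Cext Dy);
    [| | exact (is_derive_on_Cscal Dy (/ (2 * Ci))%C _ _
                  (is_derive_on_Cminus Dy _ _ _ _ Hz Hn))].
  - intros t _. unfold Csin, Cdiv. ring.
  - unfold Ccos. field; auto. }
eapply (is_derive_on_Cext Dy);
  [| | exact (is_derive_on_Cmult Dy _ _ _ _ Hsin (is_derive_on_Cinv Dy _ _ Hc Hcos))];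
  [reflexivity |].
unfold Ctan. field; auto.
Qed.

(** * Uniqueness for [a' = h a] and integration of [p' = m p^2] *)

Lemma linear_ode_zero (J : R -> Prop) (h a : R -> C) (y0 y1 : R) :
  interval J -> continuous_on J h ->
  (forall y, J y -> is_derive_on J a y (h y * a y)%C) ->
  J y0 -> J y1 -> a y0 = RtoC 0 -> a y1 = RtoC 0.
Proof.
intros HJ Hh Ha J0 J1 E0.
destruct (ex_antiderivative_on J h HJ Hh) as [H dH].
(* The integrating factor [exp (- H)] makes the product constant on [J]. *)
assert (E : (a y0 * Cexp (- (1) * H y0) = a y1 * Cexp (- (1) * H y1))%C).
{ apply (is_derive_on_zero_Ceq J (fun t => a t * Cexp (- (1) * H t))%C); auto.
  intros y Jy. eapply (is_derive_on_Cext Jy);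
    [reflexivity | | exact (is_derive_on_Cmult Jy _ _ _ _ (Ha y Jy)
       (is_derive_on_Cexp Jy _ _ (is_derive_on_Cscal Jy (- (1))%C _ _ (dH y Jy))))].
  cbv beta. ring. }
rewrite E0, Cmult_0_l in E.
destruct (Ceq_dec (a y1) 0) as [Z | N]; auto.
exfalso. symmetry in E. revert E. apply Cmult_neq_0; auto. apply Cexp_neq0.
Qed.

(** The form [(c - M) p = 1] records both that [p] has no zero and that [1 / p = c - M], which holds
    since [(1 / p)' = - m]. Differentiability of [m] yields continuity of the coefficient [m p]. *)
Lemma quadratic_ode (J : R -> Prop) (m m' M p : R -> C) :
  interval J ->
  (forall y, J y -> is_derive_on J m y (m' y)) ->
  antiderivative_on J m M ->
  (forall y, J y -> is_derive_on J p y (m y * (p y * p y))%C) ->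
  (forall y, J y -> p y = RtoC 0) \/
  (exists c : C, forall y, J y -> ((c - M y) * p y)%C = RtoC 1).
Proof.
intros HJ Hm HM Hp.
destruct (classic (exists y0, J y0 /\ p y0 = RtoC 0)) as [[y0 [J0 E0]] | N].
- left. intros y Jy.
  (* The equation is read as [p' = (m p) p], linear with a known coefficient, so one zero of [p]
     spreads to all of [J]. *)
  apply (linear_ode_zero J (fun t => m t * p t)%C p y0); auto.
  + intros t Jt.
    exact (is_derive_on_continuous _ _
             (is_derive_on_Cmult Jt _ _ _ _ (Hm t Jt) (Hp t Jt))).
  + intros t Jt. eapply (is_derive_on_Cext Jt); [reflexivity | | exact (Hp t Jt)].
    cbv beta. ring.
- right. destruct (proj1 HJ) as [x0 [_ [_ [J0 _]]]].
  exists (/ p x0 + M x0)%C. intros y Jy.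
  assert (Np : forall t, J t -> p t <> RtoC 0).
  { intros t Jt E. apply N. exists t. auto. }
  assert (E : (/ p x0 + M x0 = / p y + M y)%C).
  { apply (is_derive_on_zero_Ceq J (fun t => / p t + M t)%C); auto.
    intros t Jt. pose proof (Np t Jt) as Nt. eapply (is_derive_on_Cext Jt);
      [reflexivity | | exact (is_derive_on_Cplus _ _ _ _
         (is_derive_on_Cinv Jt _ _ Nt (Hp t Jt)) (HM t Jt))].
    cbv beta. field; auto. }
  rewrite E. field; auto.
Qed.

(** * The Riccati equation in the variable [w = v / s] *)

Section Riccati.

Context {I : R -> Prop} {f k : R -> R} {K : R} {s g g' G : R -> C}
  (s_neq0 : forall y, I y -> s y <> RtoC 0)
  (f_eq : forall y, I y -> RtoC (f y) = (s y * g y)%C)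
  (k_eq : forall y, I y -> RtoC (k y) = (g y / s y)%C)
  (s_derive : forall y, I y -> is_derive_on I s y (K * (s y * g y))%C)
  (g_derive : forall y, I y -> is_derive_on I g y (g' y))
  (G_derive : antiderivative_on I g G).

(** The term [K s g w] coming from [s'] cancels [- K w], leaving [s g (1 + w^2) = f + k (s w)^2].
    [D] may be any subset of [I], as the domain of a formula can be disconnected. *)
Lemma riccati_scaled (D : R -> Prop) (w : R -> C) :
  (forall y, D y -> I y) ->
  (forall y, D y -> is_derive_on D w y (g y * (1 - K * w y + w y * w y))%C) ->
  riccati_solution D f k (fun y => s y * w y)%C.
Proof.
intros DI Hw y Dy. pose proof (DI y Dy) as Iy. pose proof (s_neq0 y Iy) as Ns.
assert (Hs := is_derive_on_sub Dy _ _ _ DI (s_derive y Iy)).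
eapply (is_derive_on_Cext Dy);
  [reflexivity | | exact (is_derive_on_Cmult Dy _ _ _ _ Hs (Hw y Dy))].
rewrite f_eq, k_eq by exact Iy. field; auto.
Qed.

(** The substitution run backwards: [- K w] arises from the derivative of [1 / s]. *)
Lemma riccati_unscaled (D : R -> Prop) (v : R -> C) :
  (forall y, D y -> I y) -> riccati_solution D f k v ->
  forall y, D y -> is_derive_on D (fun t => v t / s t)%C y
    (g y * (1 - K * (v y / s y) + (v y / s y) * (v y / s y)))%C.
Proof.
intros DI Hv y Dy. pose proof (DI y Dy) as Iy. pose proof (s_neq0 y Iy) as Ns.
assert (Hs := is_derive_on_sub Dy _ _ _ DI (s_derive y Iy)).
eapply (is_derive_on_Cext Dy);
  [reflexivity | | exact (is_derive_on_Cmult Dy _ _ _ _ (Hv y Dy)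
                            (is_derive_on_Cinv Dy _ _ Ns Hs))].
rewrite f_eq, k_eq by exact Iy. field; auto.
Qed.

(** Here [1 - K w + w^2 = (w - e)^2]; the parameter [e] treats [K = 2] and [K = -2] together. *)
Lemma general_solution_double_root (e : C) :
  (e * e)%C = RtoC 1 -> RtoC K = (2 * e)%C ->
  general_solution I f k
    (fun c y => (G y + c)%C <> RtoC 0)
    (fun c y => (s y * (- (1 / (G y + c)) + e))%C)
    [ (fun y => (s y * e)%C) ].
Proof.
intros He HK. split.
- intros c. apply riccati_scaled; [tauto |]. intros y [Iy Nc].
  set (D := fun t => I t /\ (G t + c)%C <> RtoC 0).
  assert (Dy : D y) by (split; assumption).
  assert (HG : is_derive_on D G y (g y)).
  { apply (is_derive_on_sub Dy I); [intros t [It _]; exact It | exact (G_derive y Iy)]. }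
  assert (Hc := is_derive_on_Cplus _ _ _ _ HG (is_derive_on_Cconst c)).
  assert (Hi := is_derive_on_Copp Dy _ _ (is_derive_on_Cinv Dy _ _ Nc Hc)).
  eapply (is_derive_on_Cext Dy);
    [| | exact (is_derive_on_Cplus _ _ _ _ Hi (is_derive_on_Cconst e))].
  + intros t _. unfold Cdiv. cbv beta. ring.
  + cbv beta. rewrite HK.
    (* [1 - e * e] is zero; keeping it makes the second equation a pure field identity. *)
    transitivity (g y * (1 - e * e + / (G y + c) * / (G y + c)))%C.
    * rewrite He. field; auto.
    * field; auto.
- intros J v HJ JI Hv.
  destruct (quadratic_ode J g g' G (fun y => v y / s y - e)%C HJ) as [Z | [c Hc]].
  + intros y Jy. exact (is_derive_on_sub Jy _ _ _ JI (g_derive y (JI y Jy))).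
  + intros y Jy. exact (is_derive_on_sub Jy _ _ _ JI (G_derive y (JI y Jy))).
  + intros y Jy. eapply (is_derive_on_Cext Jy);
      [reflexivity | | exact (is_derive_on_Cminus Jy _ _ _ _
         (riccati_unscaled J v JI Hv y Jy) (is_derive_on_Cconst e))].
    rewrite HK, <- He. ring.
  + right. exists (fun y => s y * e)%C. split; [left; reflexivity |].
    intros y Jy. pose proof (s_neq0 y (JI y Jy)) as Ns.
    transitivity (s y * (v y / s y - e + e))%C; [field; auto |].
    rewrite (Z y Jy). ring.
  (* Since [w - e = 1 / (c - G) = - 1 / (G + (- c))], the constant of the family is [- c]. *)
  + left. exists (- c)%C. intros y Jy. pose proof (s_neq0 y (JI y Jy)) as Ns.
    pose proof (Hc y Jy) as E. cbv beta in E.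
    assert (N : (c - G y)%C <> RtoC 0).
    { intros Z. rewrite Z, Cmult_0_l in E. symmetry in E. exact (C1_neq0 E). }
    assert (N' : (G y + - c)%C <> RtoC 0).
    { intros Z. apply N. replace (c - G y)%C with (- (G y + - c))%C by ring.
      rewrite Z. ring. }
    split; [exact N' |].
    transitivity (s y * (v y / s y - e + e))%C; [field; auto |].
    f_equal. f_equal. rewrite <- E. field; auto.
Qed.

(** For [w = r T + K / 2] with [T] the tangent, both [w'] and [g (1 - K w + w^2)] equal
    [g r^2 (1 + T^2)], because [1 = r^2 + K^2 / 4]. *)
Lemma general_solution_tan (r : C) :
  r <> RtoC 0 -> (r * r)%C = RtoC (1 - K ^ 2 / 4) ->
  general_solution I f k
    (fun c y => Ccos (r * (G y + c))%C <> RtoC 0)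
    (fun c y => (s y * (r * Ctan (r * (G y + c)) + K / 2))%C)
    [ (fun y => (s y * (r * Ci + K / 2))%C);
      (fun y => (s y * (r * - Ci + K / 2))%C) ].
Proof.
intros Nr Hr.
assert (HK : RtoC 1 = (r * r + K * K / 4)%C).
{ rewrite Hr. transitivity (RtoC (1 - K ^ 2 / 4 + K * K / 4)); [f_equal; field |].
  rewrite RtoC_plus, (RtoC_div (K * K)), RtoC_mult by lra. reflexivity. }
pose proof Ci_neq0 as Ni. pose proof C2_neq0 as N2.
split.
- intros c. apply riccati_scaled; [tauto |]. intros y [Iy Nc].
  set (D := fun t => I t /\ Ccos (r * (G t + c))%C <> RtoC 0).
  assert (Dy : D y) by (split; assumption).
  assert (HG : is_derive_on D G y (g y)).
  { apply (is_derive_on_sub Dy I); [intros t [It _]; exact It | exact (G_derive y Iy)]. }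
  assert (Hc := is_derive_on_Cscal Dy r _ _
                  (is_derive_on_Cplus _ _ _ _ HG (is_derive_on_Cconst c))).
  assert (Ht := is_derive_on_Cscal Dy r _ _ (is_derive_on_Ctan Dy _ _ Nc Hc)).
  eapply (is_derive_on_Cext Dy);
    [reflexivity | | exact (is_derive_on_Cplus _ _ _ _ Ht (is_derive_on_Cconst (K / 2)%C))].
  set (T := Ctan (r * (G y + c))%C). cbv beta.
  rewrite HK at 2.
  field; auto.
- intros J v HJ JI Hv.
  (* [d] is the difference of the roots [i r + K / 2] and [- i r + K / 2] of [1 - K w + w^2]; [a]
     measures [w] from the first. *)
  set (d := (2 * Ci * r)%C).
  assert (Nd : d <> RtoC 0).
  { unfold d. apply Cmult_neq_0; [apply Cmult_neq_0 |]; assumption. }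
  set (a := fun y => (v y / s y - (r * Ci + K / 2))%C).
  set (E := fun y => Cexp (d * G y)).
  set (F := fun y => Cexp (- (d * G y))).
  assert (EF : forall y, (E y * F y)%C = RtoC 1) by (intros y; apply Cexp_opp).
  assert (HG : antiderivative_on J g G).
  { intros y Jy. exact (is_derive_on_sub Jy _ _ _ JI (G_derive y (JI y Jy))). }
  assert (dE : forall y, J y -> is_derive_on J E y (d * g y * E y)%C).
  { intros y Jy. exact (is_derive_on_Cexp Jy _ _ (is_derive_on_Cscal Jy d _ _ (HG y Jy))). }
  assert (dF : forall y, J y -> is_derive_on J F y (- (d * g y) * F y)%C).
  { intros y Jy. exact (is_derive_on_Cexp Jy _ _
      (is_derive_on_Copp Jy _ _ (is_derive_on_Cscal Jy d _ _ (HG y Jy)))). }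
  assert (da : forall y, J y -> is_derive_on J a y (g y * (a y * a y + d * a y))%C).
  { intros y Jy. eapply (is_derive_on_Cext Jy);
      [reflexivity | | exact (is_derive_on_Cminus Jy _ _ _ _
         (riccati_unscaled J v JI Hv y Jy) (is_derive_on_Cconst (r * Ci + K / 2)%C))].
    replace (v y / s y)%C with (a y + (r * Ci + K / 2))%C by (unfold a; ring).
    rewrite HK. unfold d.
    (* [field] treats [Ci] as an indeterminate, so the last two terms stay until [Ci_mult] cancels
       them. *)
    transitivity (g y * (a y * a y + 2 * Ci * r * a y + r * r + r * r * (Ci * Ci)))%C.
    - field; auto.
    - rewrite Ci_mult. ring. }
  destruct (quadratic_ode J (fun y => g y * E y)%C
              (fun y => g' y * E y + g y * (d * g y * E y))%C
              (fun y => / d * E y)%C (fun y => a y * F y)%C HJ) as [Z | [c Hc]].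
  + intros y Jy. exact (is_derive_on_Cmult Jy _ _ _ _
      (is_derive_on_sub Jy _ _ _ JI (g_derive y (JI y Jy))) (dE y Jy)).
  + intros y Jy. eapply (is_derive_on_Cext Jy);
      [reflexivity | | exact (is_derive_on_Cscal Jy (/ d)%C _ _ (dE y Jy))].
    field; auto.
  + intros y Jy. eapply (is_derive_on_Cext Jy);
      [reflexivity | | exact (is_derive_on_Cmult Jy _ _ _ _ (da y Jy) (dF y Jy))].
    transitivity (g y * a y * a y * F y * 1)%C; [ring |].
    rewrite <- (EF y). ring.
  + right. exists (fun y => (s y * (r * Ci + K / 2))%C). split; [left; reflexivity |].
    intros y Jy. pose proof (s_neq0 y (JI y Jy)) as Ns.
    transitivity (s y * (a y * 1 + (r * Ci + K / 2)))%C.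
    { unfold a. field; auto. }
    rewrite <- (EF y) at 1.
    replace (a y * (E y * F y))%C with (E y * (a y * F y))%C by ring.
    rewrite (Z y Jy). ring.
  + assert (Ha : forall y, J y -> ((c - / d * E y) * a y)%C = E y).
    { intros y Jy. transitivity ((c - / d * E y) * a y * 1)%C; [ring |].
      rewrite <- (EF y) at 1.
      transitivity (E y * ((c - / d * E y) * (a y * F y)))%C; [ring |].
      rewrite (Hc y Jy). ring. }
    assert (Hv' : forall y, J y -> v y = (s y * (a y + (r * Ci + K / 2)))%C).
    { intros y Jy. pose proof (s_neq0 y (JI y Jy)) as Ns. unfold a. field; auto. }
    destruct (Ceq_dec c 0) as [Zc | Nc].
    (* With [c = 0] the relation [Ha] forces [a = - d], so [w] is the other root. *)
    * right. exists (fun y => (s y * (r * - Ci + K / 2))%C). split; [right; left; reflexivity |].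
      intros y Jy. rewrite (Hv' y Jy).
      assert (Ea : a y = (- d)%C).
      { transitivity (- d * F y * ((c - / d * E y) * a y))%C.
        - rewrite Zc. transitivity (a y * 1)%C; [ring |]. rewrite <- (EF y). field; auto.
        - rewrite (Ha y Jy). transitivity (- d * (E y * F y))%C; [ring |].
          rewrite (EF y). ring. }
      rewrite Ea. unfold d. field; auto.
    * left.
      (* The shift L / d is chosen so that exp (2 i z) = - E y / (d c), where
         z = r (G y + L / d). *)
      destruct (Cexp_surj (- (/ (d * c)))%C) as [L HL].
      { intros Z. apply C1_neq0.
        transitivity (- (/ (d * c)) * - (d * c))%C; [field; auto | rewrite Z; ring]. }
      exists (L / d)%C. intros y Jy.
      set (z := (r * (G y + L / d))%C).
      assert (HX : (Cexp (Ci * z) * Cexp (Ci * z))%C = (- (E y / (d * c)))%C).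
      { rewrite <- Cexp_plus.
        replace (Ci * z + Ci * z)%C with (d * G y + L)%C.
        - rewrite Cexp_plus, HL. unfold E, Cdiv. ring.
        - unfold z, d. field; auto. }
      (* The product of this factor with [a y] is an exponential, hence nonzero. *)
      assert (Nm : (c - / d * E y)%C <> RtoC 0).
      { intros Z. pose proof (Ha y Jy) as H. rewrite Z, Cmult_0_l in H.
        exact (Cexp_neq0 _ (eq_sym H)). }
      assert (Nm' : (c * d - E y)%C <> RtoC 0).
      { intros Z. apply Nm. transitivity (/ d * (c * d - E y))%C; [field; auto |].
        rewrite Z. ring. }
      (* With [X = exp (2 i z) = - E / (d c)], one has [c (X + 1) = c - E / d], so [Nm] is exactly
         what definedness of the tangent requires. *)
      assert (Nz : Ccos z <> RtoC 0).
      { apply Ccos_neq0. rewrite HX. intros Z. apply Nm.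
        transitivity (c * (- (E y / (d * c)) + 1))%C; [field; auto |]. rewrite Z. ring. }
      split; [exact Nz |].
      rewrite (Hv' y Jy), (Ctan_Cexp z Nz), HX.
      assert (Ea : a y = (E y / (c - / d * E y))%C).
      { rewrite <- (Ha y Jy) at 1. field; auto. }
      rewrite Ea.
      transitivity (s y * (d * E y / (c * d - E y) + (r * Ci + K / 2)))%C.
      { field; auto. }
      (* Only the [d] in the numerator is expanded: the one in [c d - E] stays opaque, and [Nm']
         still applies to the denominator. *)
      replace (d * E y)%C with (2 * Ci * r * E y)%C by reflexivity.
      field. repeat split; auto.
      replace (- E y + d * c)%C with (c * d - E y)%C by ring. exact Nm'.
Qed.


End Riccati.

(** * Closure of quadratures under differences and trigonometric functions *)

Lemma by_quadratures_minus (D : R -> Prop) (f k : R -> R) (u w : R -> C) :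
  by_quadratures D f k u -> by_quadratures D f k w ->
  by_quadratures D f k (fun y => u y - w y)%C.
Proof.
intros Hu Hw.
apply bq_ext with (fun y => u y + - (1) * w y)%C.
- apply bq_plus; [exact Hu |]. apply bq_mult; [apply bq_const | exact Hw].
- intros y _. ring.
Qed.

(** Euler's formulas; dividing by [2] or [2 Ci] is a product with a constant and leaves no side
    condition on [D]. *)
Lemma by_quadratures_Ccos_Csin (D : R -> Prop) (f k : R -> R) (u : R -> C) :
  by_quadratures D f k u ->
  by_quadratures D f k (fun y => Ccos (u y)) /\ by_quadratures D f k (fun y => Csin (u y)).
Proof.
intros Hu.
assert (Hp : by_quadratures D f k (fun y => Cexp (Ci * u y))).
{ apply bq_exp, bq_mult; [apply bq_const | exact Hu]. }
assert (Hm : by_quadratures D f k (fun y => Cexp (- (Ci * u y)))).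
{ apply bq_exp. apply bq_ext with (fun y => - Ci * u y)%C.
  - apply bq_mult; [apply bq_const | exact Hu].
  - intros y _. ring. }
split.
- apply (bq_mult D f k (fun y => Cexp (Ci * u y) + Cexp (- (Ci * u y)))%C
           (fun _ => (/ 2)%C)); [apply bq_plus; assumption | apply bq_const].
- apply (bq_mult D f k (fun y => Cexp (Ci * u y) - Cexp (- (Ci * u y)))%C
           (fun _ => (/ (2 * Ci))%C)); [apply by_quadratures_minus; assumption | apply bq_const].
Qed.

Lemma by_quadratures_Ctan (D : R -> Prop) (f k : R -> R) (u : R -> C) :
  by_quadratures D f k u -> (forall y, D y -> Ccos (u y) <> RtoC 0) ->
  by_quadratures D f k (fun y => Ctan (u y)).
Proof.
intros Hu Hn. destruct (by_quadratures_Ccos_Csin D f k u Hu) as [Hc Hs].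
apply (bq_mult D f k (fun y => Csin (u y)) (fun y => / Ccos (u y))%C Hs).
apply bq_inv; assumption.
Qed.

(** * Solution formulas and integrability by quadratures *)

Theorem theorem5 (I : R -> Prop) (f k : R -> R) (K : R) (s g : R -> C)
  (I_interval : interval I)
  (f_smooth : smooth_on I f) (k_smooth : smooth_on I k)
  (f_neq0 : forall y, I y -> f y <> 0) (k_neq0 : forall y, I y -> k y <> 0)
  (sg_roots : root_branches I f k s g)
  (condition : forall y, I y -> is_derive_on I s y (RtoC (K * f y))) :
  exactly_integrable I f k /\
  (forall G : R -> C, antiderivative_on I g G ->
    (K <> 2 -> K <> -2 ->
     forall r : C, (r * r)%C = RtoC (1 - K ^ 2 / 4) ->
     general_solution I f k
       (fun c y => Ccos (r * (G y + c))%C <> RtoC 0)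
       (fun c y => (s y * (r * Ctan (r * (G y + c)) + K / 2))%C)
       [ (fun y => (s y * (r * Ci + K / 2))%C);
         (fun y => (s y * (r * - Ci + K / 2))%C) ]) /\
    (K = -2 ->
     general_solution I f k
       (fun c y => (G y + c)%C <> RtoC 0)
       (fun c y => (s y * (- (1 / (G y + c)) - 1))%C)
       [ (fun y => (s y * - (1))%C) ]) /\
    (K = 2 ->
     general_solution I f k
       (fun c y => (G y + c)%C <> RtoC 0)
       (fun c y => (s y * (- (1 / (G y + c)) + 1))%C)
       [ (fun y => (s y * 1)%C) ])).
Proof.
assert (ss : forall y, I y -> (s y * s y)%C = (f y * / k y)%C).
{ intros y Iy. rewrite (proj1 (sg_roots y Iy)). unfold Rdiv.
  rewrite RtoC_mult, RtoC_inv by auto. reflexivity. }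
assert (f_eq : forall y, I y -> RtoC (f y) = (s y * g y)%C).
{ intros y Iy. symmetry. apply (sg_roots y Iy). }
assert (s_neq0 : forall y, I y -> s y <> RtoC 0).
{ intros y Iy E. apply (f_neq0 y Iy), RtoC_inj. rewrite (f_eq y Iy), E. ring. }
assert (kC_neq0 : forall y, I y -> RtoC (k y) <> RtoC 0).
{ intros y Iy E. exact (k_neq0 y Iy (RtoC_inj _ _ E)). }
assert (g_eq : forall y, I y -> g y = (f y * / s y)%C).
{ intros y Iy. rewrite (f_eq y Iy). field; auto. }
assert (k_eq : forall y, I y -> RtoC (k y) = (g y / s y)%C).
{ intros y Iy. rewrite (g_eq y Iy).
  transitivity (k y * (s y * s y) / (s y * s y))%C; [field; auto |].
  rewrite (ss y Iy) at 1. field; auto. }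
assert (s_derive : forall y, I y -> is_derive_on I s y (K * (s y * g y))%C).
{ intros y Iy. rewrite <- (f_eq y Iy), <- RtoC_mult. exact (condition y Iy). }
(* Differentiability of [g] comes from [g = f / s]: [d 0] agrees with [f] on [I] and has derivative
   [d 1]. *)
assert (Hg : exists g', forall y, I y -> is_derive_on I g y (g' y)).
{ destruct f_smooth as [d [d0 d1]].
  exists (fun y => d 1%nat y * / s y + d 0%nat y * - (K * (s y * g y) / (s y * s y)))%C.
  intros y Iy. eapply (is_derive_on_Cext Iy);
    [| reflexivity | exact (is_derive_on_Cmult Iy _ _ _ _
        (is_derive_on_RtoC Iy _ _ (d1 0%nat y Iy))
        (is_derive_on_Cinv Iy _ _ (s_neq0 y Iy) (s_derive y Iy)))].
  intros t It. cbv beta. rewrite (d0 t It), (g_eq t It). reflexivity. }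
destruct Hg as [g' g_derive].
(* The formulas come first, since integrability is read off from their completeness. *)
match goal with |- _ /\ ?P => assert (Hsol : P) end.
{ intros G HG. split; [| split].
  - intros K2 Km2 r Hr.
    apply (general_solution_tan s_neq0 f_eq k_eq s_derive g_derive HG); [| exact Hr].
    (* [r = 0] would give [K^2 = 4]. *)
    intros E. rewrite E, Cmult_0_l in Hr. apply RtoC_inj in Hr.
    assert (E2 : (K - 2) * (K + 2) = 0) by lra.
    apply Rmult_integral in E2. lra.
  - intros EK.
    (* Complex subtraction of [1] unfolds to adding [- (1)], which is the double root here. *)
    apply (general_solution_double_root s_neq0 f_eq k_eq s_derive g_derive HG (- (1))%C).
    + ring.
    + rewrite EK. apply injective_projections; simpl; ring.
  - intros EK.
    apply (general_solution_double_root s_neq0 f_eq k_eq s_derive g_derive HG (RtoC 1)).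
    + ring.
    + rewrite EK. ring. }
split; [| exact Hsol].
destruct (ex_antiderivative_on I g I_interval) as [G HG].
{ intros y Iy. exact (is_derive_on_continuous _ _ (g_derive y Iy)). }
intros J v HJ JI Hv.
(* [s] is a square root of the nonvanishing [f / k], and a continuous branch because it is
   differentiable. *)
assert (qs : by_quadratures J f k s).
{ apply bq_sqrt with (fun y => f y * / k y)%C.
  - apply (bq_mult J f k (fun y => RtoC (f y)) (fun y => / k y)%C); [apply bq_f |].
    apply (bq_inv J f k (fun y => RtoC (k y))); [apply bq_k | auto].
  - intros y Jy. rewrite <- (ss y (JI y Jy)). apply Cmult_neq_0; auto.
  - intros y Jy.
    exact (is_derive_on_continuous _ _
             (is_derive_on_sub Jy _ _ _ JI (s_derive y (JI y Jy)))).
  - auto. }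
assert (qG : by_quadratures J f k G).
{ apply bq_int with g.
  - apply bq_ext with (fun y => f y * / s y)%C; [| auto].
    apply (bq_mult J f k (fun y => RtoC (f y))); [apply bq_f |].
    apply bq_inv; auto.
  - intros y Jy. exact (is_derive_on_sub Jy _ _ _ JI (HG y (JI y Jy))). }
assert (q2 : forall c : C, (forall y, J y -> (G y + c)%C <> RtoC 0) -> forall e : C,
  by_quadratures J f k (fun y => s y * (- (1 / (G y + c)) + e))%C).
{ intros c Hc e. apply bq_mult; [exact qs |]. apply bq_plus; [| apply bq_const].
  apply bq_ext with (fun y => - (1) * / (G y + c))%C.
  - apply bq_mult; [apply bq_const |].
    apply bq_inv; [apply bq_plus; [exact qG | apply bq_const] | exact Hc].
  - intros y Jy. field; auto. }
(* Every exceptional solution is a constant multiple of [s]. *)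
assert (qc : forall c : C, by_quadratures J f k (fun y => s y * c)%C).
{ intros c. apply bq_mult; [exact qs | apply bq_const]. }
destruct (Hsol G HG) as [Ht [Hm Hp]].
destruct (Req_dec K 2) as [K2 | K2]; [| destruct (Req_dec K (-2)) as [Km2 | Km2]].
- destruct (proj2 (Hp K2) J v HJ JI Hv) as [[c Hc] | [u [Hu E]]].
  + apply bq_ext with (1 := q2 c (fun y Jy => proj1 (Hc y Jy)) (RtoC 1)).
    intros y Jy. apply Hc, Jy.
  + destruct Hu as [<- | []]. apply bq_ext with (1 := qc _) (2 := E).
- destruct (proj2 (Hm Km2) J v HJ JI Hv) as [[c Hc] | [u [Hu E]]].
  + apply bq_ext with (1 := q2 c (fun y Jy => proj1 (Hc y Jy)) (- (1))%C).
    intros y Jy. apply Hc, Jy.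
  + destruct Hu as [<- | []]. apply bq_ext with (1 := qc _) (2 := E).
(* Any complex root will do; it is imaginary when [K^2 > 4]. *)
- destruct (Csqrt_R (1 - K ^ 2 / 4)) as [r Hr].
  destruct (proj2 (Ht K2 Km2 r Hr) J v HJ JI Hv) as [[c Hc] | [u [Hu E]]].
  + apply bq_ext with (fun y => (s y * (r * Ctan (r * (G y + c)) + K / 2))%C);
      [| intros y Jy; apply Hc, Jy].
    apply bq_mult; [exact qs |]. apply bq_plus; [| apply bq_const].
    apply bq_mult; [apply bq_const |].
    apply by_quadratures_Ctan; [| intros y Jy; apply Hc, Jy].
    apply bq_mult; [apply bq_const |]. apply bq_plus; [exact qG | apply bq_const].
  + destruct Hu as [<- | [<- | []]]; apply bq_ext with (1 := qc _) (2 := E).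
Qed.
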